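(* Let $X_0,X_1,X_2$ be a real-valued (possibly time-inhomogeneous) Markov chain with transition kernels $p_1$ (from $X_0$ to $X_1$) and $p_2$ (from $X_1$ to $X_2$), both of which are stochastically monotone. Assume that $p_1$ has an invariant distribution $\pi_1$ and that $X_0$ is $\pi_1$-distributed. Then for every Borel supermodular $h:\mathbb{R}^2\to\mathbb{R}$, $$\mathbb{E}\,h(X_0,X_2)\le \mathbb{E}\,h(X_1,X_2)$$ whenever these means exist and are finite. In particular, for any nondecreasing $f_1,f_2:\mathbb{R}\to\mathbb{R}$ for which the means of $f_1(X_0)$, $f_2(X_2)$, $f_1(X_0)f_2(X_2)$ and $f_1(X_1)f_2(X_2)$ exist and are finite, $$0\le \mathrm{Cov}(f_1(X_0),f_2(X_2))\le \mathrm{Cov}(f_1(X_1),f_2(X_2)).$$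
   Context: A Markov transition kernel $p(x,A)$ ($x\in\mathbb{R}$, $A\subset\mathbb{R}$ Borel) is such that $p(\cdot,A)$ is a Borel function for every Borel $A$ and $p(x,\cdot)$ is a probability measure for every $x$. It is stochastically monotone if $p(x,(y,\infty))$ is nondecreasing in $x$ for each $y\in\mathbb{R}$. A Markov chain has transition kernels $p_1,p_2,\ldots$ if the conditional distribution of $X_n$ given $X_0,\ldots,X_{n-1}$ is $p_n(X_{n-1},\cdot)$. A probability measure $\pi$ is invariant for a kernel $p$ if $\int_{\mathbb{R}}p(x,A)\,\pi(\mathrm{d}x)=\pi(A)$ for every Borel $A$. A function $h:\mathbb{R}^2\to\mathbb{R}$ is supermodular if $h(x_1,y_2)+h(x_2,y_1)\le h(x_1,y_1)+h(x_2,y_2)$ whenever $x_1\le x_2$ and $y_1\le y_2$. *)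

(* Defs.v *)
From HB Require Import structures.
From mathcomp Require Export all_boot all_order all_algebra.
From mathcomp Require Export all_classical all_reals all_analysis.

Set Implicit Arguments.
Unset Strict Implicit.
Unset Printing Implicit Defensive.

Import Order.TTheory GRing.Theory Num.Theory.

Local Open Scope classical_set_scope.
Local Open Scope ring_scope.
Local Open Scope ereal_scope.

Definition stochastically_monotone (R : realType) (p : R.-pker R ~> R) : Prop :=
  forall y x1 x2 : R, (x1 <= x2)%R ->
    p x1 `]y, +oo[%classic <= p x2 `]y, +oo[%classic.

Definition invariant_distribution (R : realType) (p : R.-pker R ~> R)
    (mu : probability R R) : Prop :=
  forall A : set R, measurable A -> \int[mu]_x p x A = mu A.

(* For [k] measurable in its first argument: P(Y \in B | Z) = k(Z, B) a.s. for
   every [B], spelled out by integrating over the events Z^-1(C), which are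
   exactly the members of the sigma-algebra generated by [Z]. *)
Definition conditional_distribution d d' d'' (T : measurableType d)
    (S : measurableType d') (U : measurableType d'') (R : realType)
    (P : probability T R) (Y : T -> U) (Z : T -> S)
    (k : S -> set U -> \bar R) : Prop :=
  forall (C : set S) (B : set U), measurable C -> measurable B ->
    P (Z @^-1` C `&` Y @^-1` B) = \int[P]_(w in Z @^-1` C) k (Z w) B.

Definition markov_chain3 d (T : measurableType d) (R : realType)
    (P : probability T R) (X0 X1 X2 : {RV P >-> R})
    (p1 p2 : R.-pker R ~> R) : Prop :=
  conditional_distribution P X1 X0 (fun x => p1 x) /\
  conditional_distribution P X2 (fun w => (X0 w, X1 w)) (fun x => p2 x.2).

Definition supermodular (R : realType) (h : R * R -> R) : Prop :=
  forall x1 x2 y1 y2 : R, (x1 <= x2)%R -> (y1 <= y2)%R ->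
    (h (x1, y2) + h (x2, y1) <= h (x1, y1) + h (x2, y2))%R.

(* Main.v *)
From HB Require Import structures.
Require Import Defs.
From mathcomp Require Import ring lra measurable_realfun.

(** Write [X], [Y], [Z] for [X0], [X1], [X2]. Since [pi1] is invariant, [X] and
    [Y] have the same law, and [Z] has conditional law [p2 Y] given [(X, Y)].
    For [a <= b] let [J a b s] be the integral of [h (b, y) - h (a, y)] against
    [p2 s (dy)]: the integrand is nondecreasing in [y] because [h] is
    supermodular, so [J a b s] is nondecreasing in [s] because [p2] is
    stochastically monotone. Suppose that some function [phi] satisfies
      [J a b a <= phi b - phi a <= J a b b]  for all [a <= b];
    informally, [phi] is the integral of [J (dt) t]. Taking [s = Y] and
    distinguishing [X <= Y] from [Y <= X], one finds in both cases that the
    conditional mean of [h (Y, Z) - h (X, Z)] given [(X, Y)] is at least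
    [phi Y - phi X]. The mean of the latter is zero since [phi X] and [phi Y]
    have the same law, and the inequality follows.

    Only [h (X, Z)] and [h (Y, Z)] are known to be integrable, which raises two
    difficulties. First, [phi X] may fail to be integrable. Truncation shows
    that the positive and the negative part of [phi Y - phi X] always have the
    same mean, finite or not ([same_law_integral_posB]), and this is enough
    ([same_law_le_integral]). Second, [J a b s] may be infinite or undefined. So
    the increments of [h] are split at [y = 0] into an upper and a lower part,
    whose means [mean_up] and [mean_down] are well defined in [[0, +oo]] and
    additive in the interval [[a, b]]. Each of them admits an additive [rho] in
    the role of [phi b - phi a] ([exists_diagonal_integral]). It may be
    infinite, but being at finite [rho]-distance is an equivalence relation, and
    [rho] has a measurable primitive on its classes ([primitive]). It remains to
    see that [X] and [Y] almost surely lie in the same class. Integrability of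
    [h (Y, Z) - h (X, Z)] gives this for the upper part when [X <= Y], and for
    the lower part when [Y <= X]. The other two cases follow because the laws
    of [X] and [Y] agree: a pair that never moves up across classes cannot move
    down either ([ae_linked]).

    The upper bound on the covariance is the case [h (x, y) = f1 x * f2 y], the
    means of [f1 X] and [f1 Y] being equal. Nonnegativity is the same comparison
    for [(X', X, Z)], where [X'] is an independent copy of [X] and [Z] is driven
    by [X] through the two-step kernel, which inherits monotonicity from [p1] and
    [p2]; and the mean of [f1 X' * f2 Z] is the product of the means. *)

Set Implicit Arguments.
Unset Strict Implicit.
Unset Printing Implicit Defensive.

Import Order.TTheory GRing.Theory Num.Theory.

Local Open Scope classical_set_scope.
Local Open Scope ring_scope.
Local Open Scope ereal_scope.

(** * Additive interval functions and diagonal integrals *)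

(** The mass [rho a b] of the interval from [a] to [b], without any continuity
    in the endpoints: the functions of interest may jump on either side of a
    point. *)
Definition interval_additive (R : realType) (rho : R -> R -> \bar R) : Prop :=
  (forall a b, (a <= b)%R -> 0 <= rho a b) /\
  (forall a b c, (a <= b)%R -> (b <= c)%R -> rho a c = rho a b + rho b c).

Section upper_integral.
Context (R : realType) (K : R -> R -> R -> \bar R).
Hypothesis K_add : forall s, interval_additive (fun a b => K a b s).
Hypothesis K_mono : forall a b s t, (a <= b)%R -> (s <= t)%R ->
  K a b s <= K a b t.

(** Riemann sum of [K (dt) t] over the chain from [a] through [l] to [b], where
    [K] is evaluated at the right end of each step. As [K a b s] is
    nondecreasing in [s], these sums are upper sums. *)
Fixpoint chain_sum (a : R) (l : seq R) (b : R) : \bar R :=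
  if l is t :: l' then K a t t + chain_sum t l' b else K a b b.

Definition upper_integral (a b : R) : \bar R :=
  ereal_inf [set chain_sum a l b | l in [set l | path <=%R a (rcons l b)]].

Lemma chain_path_le (a b : R) (l : seq R) : path <=%R a (rcons l b) ->
  (a <= b)%R.
Proof.
move=> /(order_path_min le_trans) /allP; apply.
by rewrite mem_rcons mem_head.
Qed.

Lemma chain_sum_lbound (a b : R) (l : seq R) : path <=%R a (rcons l b) ->
  K a b a <= chain_sum a l b.
Proof.
elim: l a => [|t l IH] a /=; first by rewrite andbT => ab; exact: K_mono.
move=> /andP[at_ p]; have tb := chain_path_le p.
rewrite ((K_add a).2 _ _ _ at_ tb) leeD ?K_mono//.
by apply: le_trans (IH _ p); exact: K_mono.
Qed.

Lemma chain_sum_cat (a b c : R) (l1 l2 : seq R) :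
  chain_sum a (l1 ++ b :: l2) c = chain_sum a l1 b + chain_sum b l2 c.
Proof. by elim: l1 a => //= t l IH a; rewrite IH addeA. Qed.

(** Inserting a point into a chain can only decrease the upper sum, since it
    replaces the parameter of the left piece by a smaller one. *)
Lemma chain_refine (a b c : R) (l : seq R) :
  (a <= b)%R -> (b <= c)%R -> path <=%R a (rcons l c) ->
  exists l1 l2, [/\ path <=%R a (rcons l1 b), path <=%R b (rcons l2 c) &
    chain_sum a l1 b + chain_sum b l2 c <= chain_sum a l c].
Proof.
elim: l a => [|t l IH] a ab bc /=.
  move=> _; exists [::], [::]; split => //=; rewrite ?andbT//.
  by rewrite ((K_add c).2 _ _ _ ab bc) leeD ?K_mono.
move=> /andP[at_ p]; have [bt|/ltW tb] := leP b t.
  exists [::], (t :: l); split => //=; rewrite ?andbT ?bt//.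
  by rewrite ((K_add t).2 _ _ _ ab bt) addeA !leeD ?K_mono.
have [l1 [l2 [p1 p2 le12]]] := IH _ tb bc p.
exists (t :: l1), l2; split => //=; first by rewrite at_.
by rewrite -addeA leeD.
Qed.

(** Concatenating chains gives subadditivity, splitting them by [chain_refine]
    gives superadditivity. *)
Lemma upper_integral_additive : interval_additive upper_integral.
Proof.
have ge0 a b : (a <= b)%R -> 0 <= upper_integral a b.
  move=> ab; apply: le_ereal_inf_tmp => _ [l /= p <-].
  by rewrite (le_trans _ (chain_sum_lbound p))// (K_add _).1.
split=> // a b c ab bc; apply/eqP; rewrite eq_le; apply/andP; split; last first.
  apply: le_ereal_inf_tmp => _ [l /= p <-].
  have [l1 [l2 [p1 p2 /(le_trans _)]]] := chain_refine ab bc p; apply.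
  by apply: leeD; apply: ereal_inf_lbound; [exists l1|exists l2].
have [->|ab_oo] := eqVneq (upper_integral a b) +oo.
  by rewrite addye ?leey// -ltNye (lt_le_trans _ (ge0 _ _ bc)).
have [->|bc_oo] := eqVneq (upper_integral b c) +oo.
  by rewrite addey ?leey// -ltNye (lt_le_trans _ (ge0 _ _ ab)).
have fab : upper_integral a b \is a fin_num by rewrite ge0_fin_numE ?ge0// ltey.
have fbc : upper_integral b c \is a fin_num by rewrite ge0_fin_numE ?ge0// ltey.
apply/lee_addgt0Pr => e e0; have e20 : (0 < e / 2)%R by rewrite divr_gt0.
have [_ [l1 /= p1 <-] lt1] := lb_ereal_inf_adherent e20 fab.
have [_ [l2 /= p2 <-] lt2] := lb_ereal_inf_adherent e20 fbc.
apply: (@le_trans _ _ (chain_sum a l1 b + chain_sum b l2 c)).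
  apply: ereal_inf_lbound; exists (l1 ++ b :: l2); last exact: chain_sum_cat.
  by rewrite /= rcons_cat rcons_cons -cat_rcons cat_path p1 last_rcons.
rewrite [e in leRHS]splitr EFinD addeACA; apply: leeD; exact: ltW.
Qed.

Lemma upper_integral_ge (a b : R) : (a <= b)%R -> K a b a <= upper_integral a b.
Proof.
by move=> ab; apply: le_ereal_inf_tmp => _ [l /= p <-]; exact: chain_sum_lbound.
Qed.

Lemma upper_integral_le (a b : R) : (a <= b)%R -> upper_integral a b <= K a b b.
Proof.
by move=> ab; apply: ereal_inf_lbound; exists [::] => //=; rewrite andbT.
Qed.

End upper_integral.

(** Here [rho a b] is meant as the integral of [K (dt) t] from [a] to [b]. The
    trivial chain gives the upper bound, and [chain_sum_lbound] the lower. *)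
Lemma exists_diagonal_integral (R : realType) (K : R -> R -> R -> \bar R) :
  (forall s, interval_additive (fun a b => K a b s)) ->
  (forall a b s t, (a <= b)%R -> (s <= t)%R -> K a b s <= K a b t) ->
  exists2 rho, interval_additive rho &
    forall a b, (a <= b)%R -> K a b a <= rho a b <= K a b b.
Proof.
move=> Kadd Kmono; exists (upper_integral K);
  first exact: upper_integral_additive.
by move=> a b ab; rewrite upper_integral_ge// upper_integral_le.
Qed.

(** Reflecting the line turns an antitone parameter into a monotone one. *)
Lemma exists_diagonal_integral_anti (R : realType) (K : R -> R -> R -> \bar R) :
  (forall s, interval_additive (fun a b => K a b s)) ->
  (forall a b s t, (a <= b)%R -> (s <= t)%R -> K a b t <= K a b s) ->
  exists2 rho, interval_additive rho &
    forall a b, (a <= b)%R -> K a b b <= rho a b <= K a b a.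
Proof.
move=> Kadd Kmono.
have [||rho rho_add Krho] :=
  @exists_diagonal_integral _ (fun a b s => K (- b) (- a) (- s))%R.
- move=> s; have [K0 KD] := Kadd (- s)%R; split=> [a b ab|a b c ab bc].
    by rewrite K0// lerN2.
  by rewrite addeC -KD// lerN2.
- by move=> a b s t ab st; rewrite Kmono ?lerN2.
exists (fun a b => rho (- b) (- a))%R => [|a b ab]; last first.
  by have := Krho (- b)%R (- a)%R; rewrite lerN2 !opprK; exact.
have [rho0 rhoD] := rho_add; split=> [a b ab|a b c ab bc].
  by rewrite rho0// lerN2.
by rewrite addeC -rhoD// lerN2.
Qed.

(** * Primitives of additive interval functions *)

Section primitive.
Context (R : realType) (rho : R -> R -> \bar R).
Hypothesis rho_add : interval_additive rho.

(** Finite distance for [rho] is an equivalence relation whose classes are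
    intervals. *)
Definition linked (x y : R) : Prop := rho (Num.min x y) (Num.max x y) < +oo.

Lemma linkedC x y : linked x y -> linked y x.
Proof. by rewrite /linked minC maxC. Qed.

Lemma linked_le x y : (x <= y)%R -> linked x y = (rho x y < +oo) :> Prop.
Proof. by move=> xy; rewrite /linked min_l// max_r. Qed.

Lemma interval_additive_sub a b c d : (a <= b)%R -> (b <= c)%R -> (c <= d)%R ->
  rho b c <= rho a d.
Proof.
move=> ab bc cd; have [ge0 add] := rho_add.
rewrite (add a b d) ?(le_trans bc cd)// (add b c d)//.
by rewrite addeCA leeDl// adde_ge0 ?ge0.
Qed.

Lemma linked_trans x y z : linked x y -> linked y z -> linked x z.
Proof.
have [ge0 add] := rho_add.
wlog xz : x z / (x <= z)%R => [wl|].
  have [xz|/ltW zx] := leP x z; first exact: wl.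
  by move=> xy yz; apply/linkedC/wl => //; exact: linkedC.
rewrite (linked_le xz) => xy yz.
have [xly|/ltW ylx] := leP x y; last first.
  apply: le_lt_trans (yz).
  by rewrite min_l ?max_r ?(le_trans ylx xz)//; exact: interval_additive_sub.
rewrite (linked_le xly) in xy.
have [ylz|/ltW zly] := leP y z; last first.
  by apply: le_lt_trans xy; exact: interval_additive_sub.
by rewrite (add x y z)// lte_add_pinfty// -(linked_le ylz).
Qed.

(** The primitive of [rho] that vanishes at [c]. It is extended real valued,
    hence useful only on the class of [c]. *)
Definition signed_rho (c s : R) : \bar R :=
  if (c <= s)%R then rho c s else - rho s c.

Lemma signed_rho_homo c : {homo signed_rho c : x y / (x <= y)%R >-> x <= y}.
Proof.
have [ge0 add] := rho_add.
move=> x y xy; rewrite /signed_rho; have [cx|cx] := leP c x.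
  by rewrite (le_trans cx xy); exact: interval_additive_sub.
have [cy|cy] := leP c y.
  by rewrite (@le_trans _ _ 0) ?ge0// leeNl oppe0 ge0// ltW.
by rewrite leeN2; apply: interval_additive_sub => //; exact: ltW.
Qed.

Lemma signed_rhoB c x y : (x <= y)%R -> linked c x -> linked x y ->
  (fine (signed_rho c y) - fine (signed_rho c x) = fine (rho x y))%R.
Proof.
have [ge0 add] := rho_add.
move=> xy cx lxy; have cy := linked_trans cx lxy.
have fin a b : (a <= b)%R -> linked a b -> rho a b \is a fin_num.
  by move=> ab; rewrite (linked_le ab) ge0_fin_numE// ge0.
rewrite /signed_rho; have [clx|/ltW xlc] := leP c x.
  rewrite (le_trans clx xy) (add c x y)// fineD ?fin//.
  by rewrite addrAC subrr add0r.
have [cly|/ltW ylc] := leP c y.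
  rewrite (add x c y)// fineD ?fin//; last exact: linkedC.
  by rewrite fineN opprK addrC.
rewrite (add x y c)// !fineN fineD ?fin//; last exact: linkedC.
by rewrite opprK addrCA [(- _ + _)%R]addrC subrr addr0.
Qed.

Let q (n : nat) : R := ratr (odflt 0%R (unpickle n)).

Let q_dense x y : (x < y)%R -> exists n, (x < q n < y)%R.
Proof.
move=> /rat_in_itvoo[r]; rewrite in_itv/= => xry.
by exists (pickle r); rewrite /q pickleK.
Qed.

Lemma measurable_upset (A : set R) :
  (forall x y, (x <= y)%R -> A x -> A y) -> measurable A.
Proof.
move=> up; apply: is_interval_measurable => x y Ax Ay z /andP[xz _].
exact: up xz Ax.
Qed.

Lemma measurable_downset (A : set R) :
  (forall x y, (x <= y)%R -> A y -> A x) -> measurable A.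
Proof.
move=> dn; apply: is_interval_measurable => x y Ax Ay z /andP[_ zy].
exact: dn zy Ay.
Qed.

Lemma measurable_linked c : measurable [set s | linked c s].
Proof.
apply: is_interval_measurable => x y cx cy z /andP[xz zy].
apply: (linked_trans cx); rewrite /= linked_le//.
have xy := linked_trans (linkedC cx) cy.
rewrite linked_le ?(le_trans xz zy)// in xy.
by apply: le_lt_trans xy; exact: interval_additive_sub.
Qed.

Let base (s : R) : set nat := [set n | linked (q n) s].

(** As [xget] depends only on the set [base s], this index depends only on the
    class of [s]. *)
Let repr (s : R) : nat := xget 0%N (base s).

(** Each class is given its own base point, a rational number that it contains.
    A class without a rational number is reduced to one point, where any value
    will do. *)
Definition primitive (s : R) : R :=
  if `[<base s !=set0>] then fine (signed_rho (q (repr s)) s) else 0%R.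

Let base_linked x y : linked x y -> base x = base y.
Proof.
move=> xy; apply/seteqP; split=> n /= nx; first exact: linked_trans nx xy.
exact: linked_trans nx (linkedC xy).
Qed.

Let repr_base s : base s !=set0 -> base s (repr s).
Proof. by move=> bs; exact: xgetPex. Qed.

(** If [x < y] are linked, then their class contains a rational number, so both
    values are taken relative to the same base point. *)
Lemma primitiveB x y : (x <= y)%R -> rho x y < +oo ->
  (primitive y - primitive x = fine (rho x y))%R.
Proof.
move=> xy rxy; have lxy : linked x y by rewrite linked_le.
have eb := base_linked lxy.
rewrite /primitive eb /repr eb; case: asboolP => [by_|nby].
  rewrite signed_rhoB//.
  by have := repr_base by_; rewrite /repr -eb.
have [xy'|yx] := ltP x y.
  exfalso; apply: nby; have [n /andP[xn ny]] := q_dense xy'.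
  exists n; rewrite /base /= linked_le ?(ltW ny)//.
  by apply: le_lt_trans rxy; apply: interval_additive_sub => //; exact: ltW.
have exy : x = y by apply/le_anti; rewrite xy.
rewrite exy subrr; have := rho_add.2 y y y (lexx _) (lexx _).
rewrite exy in rxy; have := rho_add.1 y y (lexx _).
case: (rho y y) rxy => //= r _ _ [] /eqP.
by rewrite -subr_eq0 opprD addrA subrr sub0r oppr_eq0 => /eqP.
Qed.

(** On each of the countably many classes that contain a rational number, the
    primitive is nondecreasing; elsewhere it is zero. *)
Lemma measurable_primitive : measurable_fun [set: R] primitive.
Proof.
pose F k := [set s | base s !=set0 /\ repr s = k].
(* A nonempty [F k] is the whole class of [q k]. *)
have mF k : measurable (F k).
  have [[s0 [bs0 rs0]]|nF] := pselect (F k !=set0); last first.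
    rewrite (_ : F k = set0)//; apply/seteqP; split => // s Fs.
    by apply: nF; exists s.
  have ls0 : linked (q k) s0 by rewrite -rs0; exact: repr_base.
  rewrite (_ : F k = [set s | linked (q k) s]); first exact: measurable_linked.
  apply/seteqP; split => s /=; first by move=> [/repr_base bs <-].
  move=> ks; have eb := base_linked (linked_trans (linkedC ls0) ks).
  by rewrite /F /= -eb; split=> //; rewrite -rs0 /repr eb.
pose N := ~` \bigcup_k F k.
have mN : measurable N by apply: measurableC; exact: bigcup_measurable.
have NE s : N s -> primitive s = 0%R.
  move=> Ns; rewrite /primitive; case: asboolP => // bs.
  by exfalso; apply: Ns; exists (repr s).
have FE k s : F k s -> primitive s = fine (signed_rho (q k) s).
  by move=> [bs <-]; rewrite /primitive; case: asboolP.
have fF k s : F k s -> signed_rho (q k) s \is a fin_num.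
  move=> [bs rk]; have ls : linked (q k) s by rewrite -rk; exact: repr_base.
  rewrite /signed_rho; case: leP => ks.
    by rewrite linked_le// in ls; rewrite ge0_fin_numE// rho_add.1.
  move/linkedC : ls; rewrite linked_le ?(ltW ks)// => ls.
  by rewrite fin_numN ge0_fin_numE// rho_add.1// ltW.
apply: (measurability (@RGenOInfty.G R)) => [|_ [_ [r ->] <-]].
  exact: RGenOInfty.measurableE.
rewrite setTI.
rewrite (_ : _ @^-1` _ =
   (\bigcup_k (F k `&` [set s | r%:E < signed_rho (q k) s])) `|`
   (N `&` [set s | r < 0]%R)).
  apply: measurableU; last first.
    apply: measurableI => //; case: (boolP (r < 0)%R) => r0.
      by rewrite (_ : mkset _ = setT)//; apply/seteqP; split.
    by rewrite (_ : mkset _ = set0)//; apply/seteqP; split.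
  apply: bigcup_measurable => k _; apply: measurableI => //.
  apply: measurable_upset => x y xy /= /lt_le_trans; apply.
  exact: signed_rho_homo.
apply/seteqP; split => s /=; rewrite in_itv/= andbT.
  have [[k _ Fk]|Ns] := pselect ((\bigcup_k F k) s); last first.
    by rewrite NE//; right.
  rewrite (FE k)// => rs; left; exists k => //; split => //=.
  by rewrite -[ltRHS]fineK ?fF.
move=> [[k _ [Fk /=]]|[Ns r0]]; last by rewrite NE.
by rewrite (FE k)// -[X in _ < X -> _]fineK ?fF.
Qed.

End primitive.

(** * Pairs of variables with the same law *)

Definition same_law d (T : measurableType d) (R : realType)
    (P : probability T R) (X Y : T -> R) : Prop :=
  forall A : set R, measurable A -> P (X @^-1` A) = P (Y @^-1` A).

Section same_law.
Context d (T : measurableType d) (R : realType) (P : probability T R).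
Implicit Types X Y : T -> R.

Lemma same_law_sym X Y : same_law P X Y -> same_law P Y X.
Proof. by move=> XY A mA; rewrite XY. Qed.

Lemma same_law_comp X Y (phi : R -> R) : measurable_fun setT phi ->
  same_law P X Y -> same_law P (phi \o X) (phi \o Y).
Proof.
move=> mphi XY A mA; apply: (XY (phi @^-1` A)).
by rewrite -[X in measurable X]setTI; exact: mphi.
Qed.

Lemma ge0_integral_same_law X Y (f : R -> \bar R) :
  measurable_fun setT X -> measurable_fun setT Y -> same_law P X Y ->
  measurable_fun setT f -> (forall x, 0 <= f x) ->
  \int[P]_w f (X w) = \int[P]_w f (Y w).
Proof.
move=> mX mY XY mf f0.
transitivity (\int[pushforward P X]_x f x).
  by rewrite (ge0_integral_pushforward mX)//.
transitivity (\int[pushforward P Y]_x f x).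
  by apply: eq_measure_integral => A mA _; exact: XY.
by rewrite (ge0_integral_pushforward mY)//.
Qed.

(** The events [X \in A] and [Y \in A] have the same finite probability, so if
    one contains the other then they differ by a null set. *)
Lemma same_law_invariant X Y (A : set R) :
  measurable_fun setT X -> measurable_fun setT Y -> same_law P X Y ->
  measurable A ->
  {ae P, forall w, A (Y w) -> A (X w)} -> {ae P, forall w, A (X w) -> A (Y w)}.
Proof.
move=> mfX mfY XY mA YX.
have mX : measurable (X @^-1` A).
  by rewrite -[Z in measurable Z]setTI; exact: mfX.
have mY : measurable (Y @^-1` A).
  by rewrite -[Z in measurable Z]setTI; exact: mfY.
have null : P (Y @^-1` A `\` X @^-1` A) = 0.
  apply/negligibleP; first exact: measurableD.
  apply: negligibleS YX => w [/= Aw nAw] /= h; exact/nAw/h.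
have PI (B : set T) : measurable B -> P B \is a fin_num.
  by exact: fin_num_measure.
have DI (B C : set T) : measurable B -> measurable C ->
    P B = P (B `\` C) + P (B `&` C) by exact: measureDI.
have e : P (X @^-1` A) = P (Y @^-1` A) by exact: XY.
rewrite (DI _ _ mX mY) (DI _ _ mY mX) null add0e setIC in e.
suff /negligibleP : P (X @^-1` A `\` Y @^-1` A) = 0.
  move/(_ (measurableD mX mY)); apply: negligibleS => w /= nw.
  by split; [|move=> Aw]; apply: contrapT => ?; apply: nw.
have fI := PI _ (measurableI _ _ mY mX).
by rewrite -[LHS](addeK _ fI) e subee.
Qed.

(** If the step from [X] to [Y] almost surely never goes up to another class,
    then it never goes down to one. The points above [q] that are not linked to
    [q] form an upper set [U q], and those below [q] a lower set [D q]. An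
    upward step from [X] to [Y] within a class cannot enter [U q] or leave
    [D q], so [same_law_invariant] forbids downward steps to leave [U q] or to
    enter [D q]. A downward step between two classes does one of these for any
    rational [q] strictly inside the step. *)
Lemma ae_linked (rho : R -> R -> \bar R) X Y : interval_additive rho ->
  measurable_fun setT X -> measurable_fun setT Y -> same_law P X Y ->
  {ae P, forall w, (X w <= Y w)%R -> rho (X w) (Y w) < +oo} ->
  {ae P, forall w, linked rho (X w) (Y w)}.
Proof.
move=> rho_add mX mY XY up; have [ge0 add] := rho_add.
pose U q := [set s | (q < s)%R /\ rho q s = +oo].
pose D q := [set s | (s < q)%R /\ rho s q = +oo].
have addy (a b : \bar R) : 0 <= a -> 0 <= b ->
    a + b = +oo -> a = +oo \/ b = +oo.
  by case: a b => [a| |] [b| |] //=; [right|left|left].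
have mU q : measurable (U q).
  apply: measurable_upset => x y xy [qx rqx]; split;
    first exact: lt_le_trans xy.
  by apply/eqP; rewrite -leye_eq -rqx; apply: interval_additive_sub => //;
    exact: ltW.
have mD q : measurable (D q).
  apply: measurable_downset => x y xy [yq ryq]; split;
    first exact: le_lt_trans xy yq.
  by apply/eqP; rewrite -leye_eq -ryq; apply: interval_additive_sub => //;
    exact: ltW.
have aeU q : {ae P, forall w, U q (X w) -> U q (Y w)}.
  apply: same_law_invariant => //; apply: filterS up => w up [qY rqY].
  have [XleY|YltX] := leP (X w) (Y w); last first.
    split; first exact: lt_trans YltX.
    by apply/eqP; rewrite -leye_eq -rqY; apply: interval_additive_sub => //;
      exact: ltW.
  have {}up := up XleY; have [Xq|qX] := leP (X w) q.
    by move: up; rewrite ltNge -rqY interval_additive_sub// ltW.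
  split => //; move: rqY; rewrite (add q (X w) (Y w)) ?(ltW qX)//.
  by move/addy; rewrite !ge0 ?(ltW qX)// => /(_ isT isT)[//|e]; rewrite e in up.
have aeD q : {ae P, forall w, D q (Y w) -> D q (X w)}.
  apply: same_law_invariant => //; first exact: same_law_sym.
  apply: filterS up => w up [Xq rXq].
  have [XleY|YltX] := leP (X w) (Y w); last first.
    split; first exact: lt_trans Xq.
    by apply/eqP; rewrite -leye_eq -rXq; apply: interval_additive_sub => //;
      exact: ltW.
  have {}up := up XleY; have [qY|Yq] := leP q (Y w).
    by move: up; rewrite ltNge -rXq interval_additive_sub// ltW.
  split => //; move: rXq; rewrite (add (X w) (Y w) q) ?(ltW Yq)//.
  by move/addy; rewrite !ge0 ?(ltW Yq)// => /(_ isT isT)[e|//]; rewrite e in up.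
pose q n : R := ratr (odflt 0%R (unpickle n : option rat)).
have aeUn := ae_foralln (fun n => aeU (q n)).
have aeDn := ae_foralln (fun n => aeD (q n)).
apply: filterS3 up aeUn aeDn => w up wU wD.
have [XleY|YltX] := leP (X w) (Y w); first by rewrite linked_le//; exact: up.
apply: linkedC; rewrite linked_le ?(ltW YltX)// ltey; apply/eqP => rYX.
have [r] := rat_in_itvoo YltX; rewrite in_itv/= => /andP[Yr rX].
have qr : q (pickle r) = ratr r by rewrite /q pickleK.
have := rYX; rewrite (add (Y w) (ratr r) (X w)) ?(ltW Yr) ?(ltW rX)//.
move/addy; rewrite !ge0 ?(ltW Yr) ?(ltW rX)// => /(_ isT isT)[rYr|rrX].
  have := wD (pickle r); rewrite qr => /(_ (conj Yr rYr))[+ _].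
  by rewrite ltNge (ltW rX).
have := wU (pickle r); rewrite qr => /(_ (conj rX rrX))[+ _].
by rewrite ltNge (ltW Yr).
Qed.

End same_law.

Section clamp.
Context (R : realType).
Implicit Types x y : R.

Definition clamp (n : nat) x : R := Num.max (- n%:R)%R (Num.min x n%:R).

Lemma clamp_lb n x : (- n%:R <= clamp n x)%R.
Proof. by rewrite /clamp le_max lexx. Qed.

Lemma clamp_ub n x : (clamp n x <= n%:R)%R.
Proof.
by rewrite /clamp ge_max ge_min lexx orbT andbT; have := ler0n R n; lra.
Qed.

Lemma clamp_id n x : (`|x| <= n%:R)%R -> clamp n x = x.
Proof. by rewrite ler_norml => /andP[nx xn]; rewrite /clamp min_l// max_r. Qed.

Lemma measurable_clamp n : measurable_fun setT (clamp n).
Proof. exact/measurable_maxr/measurable_minr. Qed.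

Lemma clamp_homo n x y : (x <= y)%R -> (clamp n x <= clamp n y)%R.
Proof. by move=> xy; rewrite /clamp ge_max !le_max lexx !le_min !ge_min xy
  lexx !orbT. Qed.

Lemma clamp_ler_dist n x y : (x <= y)%R -> (clamp n y - clamp n x <= y - x)%R.
Proof.
move=> xy; rewrite lerBlDr ge_max; apply/andP; split.
  by rewrite -[leLHS]add0r lerD ?subr_ge0// /clamp le_max lexx.
rewrite /clamp addr_maxr le_max; apply/orP; right.
rewrite addr_minr subrK le_min !ge_min lexx /=; apply/orP; right.
by rewrite lerDr subr_ge0.
Qed.

Lemma clamp_clamp m n x : (m <= n)%N -> clamp m (clamp n x) = clamp m x.
Proof.
move=> mn; have mnR : (m%:R <= n%:R :> R)%R by rewrite ler_nat.
have m0 : (0 <= m%:R :> R)%R by exact: ler0n.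
rewrite /clamp.
rewrite minC min_maxr (minC x) minA (min_l mnR) min_r; last first.
  by rewrite (le_trans _ m0)// oppr_le0 (le_trans m0).
by rewrite maxA (max_l (_ : - n%:R <= - m%:R)%R) ?lerN2// minC.
Qed.

(** Monotonicity in [n] makes monotone convergence applicable, so that the
    truncated differences need not be dominated by an integrable function.
    Clamping at [m] factors through clamping at [n], and it is a contraction.
    *)
Lemma clamp_posB_homo x y (m n : nat) : (m <= n)%N ->
  (Num.max (clamp m y - clamp m x) 0 <= Num.max (clamp n y - clamp n x) 0)%R.
Proof.
move=> mn; rewrite ge_max !le_max lexx orbT andbT.
rewrite -(clamp_clamp x mn) -(clamp_clamp y mn).
have [yx|/ltW xy] := leP y x; apply/orP; [right|left].
  by rewrite subr_le0 !clamp_homo.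
by rewrite clamp_ler_dist// clamp_homo.
Qed.
End clamp.

(** For truncated variables this says that bounded variables with the same law
    have the same mean, as [(v - u)^+ + u = (u - v)^+ + v]. Then let the
    truncation level tend to infinity. *)
Lemma same_law_integral_posB d (T : measurableType d) (R : realType)
    (P : probability T R) (U V : T -> R) :
  measurable_fun setT U -> measurable_fun setT V -> same_law P U V ->
  \int[P]_w (Num.max (V w - U w) 0)%:E = \int[P]_w (Num.max (U w - V w) 0)%:E.
Proof.
move=> mU mV UV.
pose D (X Y : T -> R) (n : nat) w :=
  (Num.max (clamp n (Y w) - clamp n (X w)) 0)%:E.
have mcl n (X : T -> R) : measurable_fun setT X ->
    measurable_fun setT (clamp n \o X).
  by move=> mX; apply: measurableT_comp => //; exact: measurable_clamp.
have mD X Y n : measurable_fun setT X -> measurable_fun setT Y ->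
    measurable_fun setT (D X Y n).
  move=> mX mY; apply/measurable_EFinP/measurable_maxr => //.
  by apply: measurable_funB; exact: mcl.
have D0 X Y n w : 0 <= D X Y n w by rewrite lee_fin le_max lexx orbT.
have limD X Y w : limn (D X Y ^~ w) = (Num.max (Y w - X w) 0)%:E.
  apply: lim_near_cst => //.
  have := nbhs_infty_ger (Num.max `|X w| `|Y w|)%R; apply: filterS => n.
  by rewrite ge_max => /andP[Xn Yn]; rewrite /D !clamp_id.
have cvgD X Y : measurable_fun setT X -> measurable_fun setT Y ->
    (\int[P]_w D X Y n w) @[n --> \oo] --> \int[P]_w (Num.max (Y w - X w) 0)%:E.
  move=> mX mY; under eq_integral do rewrite -limD.
  apply: cvg_monotone_convergence => //; first by move=> n; exact: mD.
  by move=> w _ m n mn; rewrite lee_fin clamp_posB_homo.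
have eqD n : \int[P]_w D U V n w = \int[P]_w D V U n w.
  pose S (X : T -> R) w := (clamp n (X w) + n%:R)%:E.
  have S0 X w : 0 <= S X w by rewrite lee_fin -lerBlDr sub0r clamp_lb.
  have mS X : measurable_fun setT X -> measurable_fun setT (S X).
    move=> mX; apply/measurable_EFinP; apply: measurable_funD => //.
    exact: mcl.
  have fS X : measurable_fun setT X -> \int[P]_w S X w \is a fin_num.
    move=> mX; rewrite ge0_fin_numE ?integral_ge0//.
    apply: (@le_lt_trans _ _ (\int[P]_w (2 * n%:R)%:E)).
      apply: ge0_le_integral => //; first exact: mS.
      by move=> w _; rewrite lee_fin mulrDl mul1r lerD ?clamp_ub.
    by rewrite integral_cst//= probability_setT mule1 ltry.
  have SUV : \int[P]_w S U w = \int[P]_w S V w.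
    apply: (@ge0_integral_same_law _ _ _ P _ _
      (fun x => (clamp n x + n%:R)%:E)) => //.
      by apply/measurable_EFinP; apply: measurable_funD => //;
        exact: measurable_clamp.
    by move=> x; rewrite lee_fin -lerBlDr sub0r clamp_lb.
  have : \int[P]_w D U V n w + \int[P]_w S U w =
         \int[P]_w D V U n w + \int[P]_w S V w.
    rewrite -!ge0_integralD//; [|exact: mD|exact: mS|exact: mD|exact: mS].
    apply: eq_integral => w _; rewrite -!EFinD; congr (_%:E).
    by rewrite /Num.max; repeat (case: ifPn; rewrite -?leNgt); lra.
  by rewrite SUV => /(congr1 (fun z => z - \int[P]_w S V w));
    rewrite !addeK ?fS.
apply: cvg_unique (cvgD _ _ mU mV) _ => //.
by rewrite (funext eqD); exact: cvgD.
Qed.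

(** The form in which [same_law_integral_posB] is used: [V - U] may be added to
    the smaller side of an inequality between integrals as if it had mean zero.
    Its positive part is dominated by [A1], hence integrable. *)
Lemma same_law_le_integral d (T : measurableType d) (R : realType)
    (P : probability T R) (U V : T -> R) (A1 A2 : T -> \bar R) :
  measurable_fun setT U -> measurable_fun setT V -> same_law P U V ->
  measurable_fun setT A1 -> (forall w, 0 <= A1 w) ->
  measurable_fun setT A2 -> (forall w, 0 <= A2 w) ->
  \int[P]_w A1 w < +oo ->
  {ae P, forall w, (V w - U w)%:E + A2 w <= A1 w} ->
  \int[P]_w A2 w <= \int[P]_w A1 w.
Proof.
move=> mU mV UV mA1 A10 mA2 A20 fA1 key.
pose Wp w := (Num.max (V w - U w) 0)%:E.
pose Wm w := (Num.max (U w - V w) 0)%:E.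
have W0 : (forall w, 0 <= Wp w) /\ (forall w, 0 <= Wm w).
  by split=> w; rewrite lee_fin le_max lexx orbT.
have mWp : measurable_fun setT Wp.
  by apply/measurable_EFinP/measurable_maxr => //; exact: measurable_funB.
have mWm : measurable_fun setT Wm.
  by apply/measurable_EFinP/measurable_maxr => //; exact: measurable_funB.
have EW : \int[P]_w Wp w = \int[P]_w Wm w.
  exact: same_law_integral_posB.
have leWp : \int[P]_w Wp w <= \int[P]_w A1 w.
  apply: ae_ge0_le_integral => //; first by move=> w _; exact: W0.1.
  apply: filterS key => w key _; rewrite /Wp EFin_max ge_max A10 andbT.
  by apply: le_trans key; rewrite leeDl.
have fWp : \int[P]_w Wp w \is a fin_num.
  rewrite ge0_fin_numE ?(le_lt_trans leWp)//.
  by apply: integral_ge0 => w _; exact: W0.1.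
have : \int[P]_w (Wp w + A2 w) <= \int[P]_w (Wm w + A1 w).
  apply: ae_ge0_le_integral => //.
  - by move=> w _; rewrite adde_ge0// W0.1.
  - exact: emeasurable_funD.
  - by move=> w _; rewrite adde_ge0// W0.2.
  - exact: emeasurable_funD.
  apply: filterS key => w key _; rewrite /Wp /Wm.
  have [pw|pw] := leP 0%R (V w - U w)%R.
    apply: (le_trans key); rewrite leeDr//.
    exact: W0.2.
  rewrite add0e.
  move: key; rewrite -leeBrDl// => /le_trans; apply.
  rewrite addeC -EFinN opprB leeD2r// lee_fin le_max.
  by rewrite lexx.
rewrite !ge0_integralD//; last 2 first.
- by move=> w _; exact: W0.2.
- by move=> w _; exact: W0.1.
by rewrite -EW leeD2lE.
Qed.

Lemma integral_same_law d (T : measurableType d) (R : realType)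
    (P : probability T R) (X Y : T -> R) (f : R -> R) :
  measurable_fun setT X -> measurable_fun setT Y -> same_law P X Y ->
  measurable_fun setT f ->
  \int[P]_w (f (X w))%:E = \int[P]_w (f (Y w))%:E.
Proof.
move=> mX mY XY mf; rewrite [LHS]integralE [RHS]integralE.
have mfp : measurable_fun setT (EFin \o f)^\+
  by exact/measurable_funepos/measurable_EFinP.
have mfn : measurable_fun setT (EFin \o f)^\-
  by exact/measurable_funeneg/measurable_EFinP.
have pE (U : T -> R) : (fun w => (f (U w))%:E)^\+ = (EFin \o f)^\+ \o U :=
  funepos_comp (EFin \o f) U.
have nE (U : T -> R) : (fun w => (f (U w))%:E)^\- = (EFin \o f)^\- \o U :=
  funeneg_comp (EFin \o f) U.
rewrite !pE !nE; congr (_ - _).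
  exact: (ge0_integral_same_law mX mY XY mfp (funepos_ge0 _)).
exact: (ge0_integral_same_law mX mY XY mfn (funeneg_ge0 _)).
Qed.

Lemma integrable_same_law d (T : measurableType d) (R : realType)
    (P : probability T R) (X Y : T -> R) (f : R -> R) :
  measurable_fun setT X -> measurable_fun setT Y -> same_law P X Y ->
  measurable_fun setT f ->
  P.-integrable setT (fun w => (f (X w))%:E) ->
  P.-integrable setT (fun w => (f (Y w))%:E).
Proof.
move=> mX mY XY mf /integrableP[_ fX]; apply/integrableP; split.
  by apply/measurable_EFinP; exact: measurableT_comp.
have mnf : measurable_fun setT (fun x => `|(f x)%:E|).
  by apply: measurableT_comp => //; exact/measurable_EFinP.
by rewrite -(ge0_integral_same_law mX mY XY mnf).
Qed.

(** * Stochastic order *)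

Section stochastic_order.
Context (R : realType) (mu nu : probability R R).
Hypothesis le_mu : forall y, mu `]y, +oo[%classic <= nu `]y, +oo[%classic.

(** An upper set is empty, the whole line, an open half-line, or a closed
    half-line; the last one is a decreasing intersection of open half-lines. *)
Lemma stoch_le_upset (A : set R) : (forall x y, (x <= y)%R -> A x -> A y) ->
  mu A <= nu A.
Proof.
move=> up; have [[a Aa]|/set0P/negP/negbNE/eqP->] := pselect (A !=set0);
  last first.
  by rewrite !measure0.
have [lbA|nlbA] := pselect (has_lbound A); last first.
  rewrite (_ : A = setT) ?probability_setT//; apply/seteqP; split=> // x _.
  apply: contrapT => nAx; apply: nlbA; exists x => y Ay.
  by have [//|/ltW yx] := leP x y; exfalso; apply/nAx/up/Ay.
have Ainf x : (inf A < x)%R -> A x.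
  rewrite -subr_gt0 => /inf_adherent -/(_ A) []; first by split => //; exists a.
  by move=> y Ay; rewrite addrC subrK => /ltW yx; exact: up yx Ay.
have infA x : A x -> (inf A <= x)%R by move=> Ax; exact: ge_inf.
have [AinfA|nAinfA] := pselect (A (inf A)); last first.
  rewrite (_ : A = `]inf A, +oo[%classic)//; apply/seteqP; split => x /=.
    rewrite in_itv/= andbT lt_neqAle => Ax; rewrite infA// andbT.
    by apply/eqP => e; apply: nAinfA; rewrite e.
  by rewrite in_itv/= andbT; exact: Ainf.
pose F k := `](inf A - k.+1%:R^-1)%R, +oo[%classic.
have mF k : measurable (F k) by exact: measurable_itv.
have AE : A = \bigcap_k F k.
  rewrite -itvcyEbigcap; apply/seteqP; split => x /=; rewrite in_itv/= andbT.
    exact: infA.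
  by move=> /up; apply.
have cvgF (m : probability R R) : (m \o F) x @[x --> \oo] --> m A.
  rewrite AE; apply: nonincreasing_cvg_mu => //.
  - by rewrite ltey_eq fin_num_measure// orbT.
  - exact: bigcap_measurable.
  - move=> i j ij; apply/subsetPset => x; rewrite /F /= !in_itv/= !andbT.
    by apply: le_lt_trans; rewrite lerB// lef_pV2 ?posrE// ler_nat.
rewrite -(cvg_lim (@ereal_hausdorff _) (cvgF mu)).
rewrite -(cvg_lim (@ereal_hausdorff _) (cvgF nu)).
apply: lee_lim; [exact: cvgP (cvgF mu)|exact: cvgP (cvgF nu)|].
by near=> n; exact: le_mu.
Unshelve. all: by end_near. Qed.

Lemma stoch_le_downset (A : set R) : (forall x y, (x <= y)%R -> A y -> A x) ->
  nu A <= mu A.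
Proof.
move=> dn; have mA : measurable A := measurable_downset dn.
have : mu (~` A) <= nu (~` A).
  by apply: stoch_le_upset => x y xy nAx Ay; apply/nAx/dn/Ay.
rewrite !probability_setC// leeBlDr ?fin_num_measure// addeAC.
by rewrite leeBrDr ?fin_num_measure// leeD2lE.
Qed.

(** The mean of a nonnegative variable is the integral of its tail
    probabilities, and the sets on which [g] exceeds a level are upper sets. *)
Lemma stoch_le_integral (g : R -> R) :
  (forall x, 0 <= g x)%R -> {homo g : x y / (x <= y)%R} ->
  \int[mu]_x (g x)%:E <= \int[nu]_x (g x)%:E.
Proof.
move=> g0 gle.
have mg : measurable_fun setT g by exact: nondecreasing_measurable.
pose G : {mfun R >-> R} := HB.pack g (isMeasurableFun.Build _ _ _ _ _ mg).
have := @ge0_expectation_ccdf _ _ _ mu G g0.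
have := @ge0_expectation_ccdf _ _ _ nu G g0.
rewrite !expectation_def => -> ->.
apply: ge0_le_integral => //.
- by apply: measurable_funTS; exact: ccdf_measurable.
- by apply: measurable_funTS; exact: ccdf_measurable.
move=> r _; apply: stoch_le_upset => x y xy /=.
by rewrite !in_itv/= !andbT => /lt_le_trans; apply; exact: gle.
Qed.

Lemma stoch_le_integral_anti (g : R -> R) :
  (forall x, 0 <= g x)%R -> {homo g : x y /~ (x <= y)%R} ->
  \int[nu]_x (g x)%:E <= \int[mu]_x (g x)%:E.
Proof.
move=> g0 gle.
have mg : measurable_fun setT g.
  by apply: nonincreasing_measurable => // x y; exact: gle.
pose G : {mfun R >-> R} := HB.pack g (isMeasurableFun.Build _ _ _ _ _ mg).
have := @ge0_expectation_ccdf _ _ _ mu G g0.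
have := @ge0_expectation_ccdf _ _ _ nu G g0.
rewrite !expectation_def => -> ->.
apply: ge0_le_integral => //.
- by apply: measurable_funTS; exact: ccdf_measurable.
- by apply: measurable_funTS; exact: ccdf_measurable.
move=> r _; apply: stoch_le_downset => x y xy /=.
by rewrite !in_itv/= !andbT => /lt_le_trans; apply; exact: gle.
Qed.

End stochastic_order.

Section kernel_prob.
Context d d' (X : measurableType d) (Y : measurableType d') (R : realType).
Variable k : R.-pker X ~> Y.

(** A copy of [k] that carries the instance of probability, since the values of
    a kernel are declared as measures only. *)
Definition kernel_prob (x : X) : set Y -> \bar R := k x.

HB.instance Definition _ x := Measure.on (kernel_prob x).
HB.instance Definition _ x :=
  Measure_isProbability.Build _ _ _ (kernel_prob x) (prob_kernel x).
End kernel_prob.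

(** * Disintegration along a conditional distribution *)

Section graph_kernel.
Context d d' (S : measurableType d) (U : measurableType d') (R : realType).
Variable k : R.-spker S ~> U.

(** The law of [(x, Y)] when [Y] has law [k x]. The component in [unit] is
    there to make this kernel composable with a constant kernel. *)
Definition graph_kernel (z : unit * S) (A : set (S * U)) : \bar R :=
  pushforward (k z.2) (pair z.2) A.

Let mpair (x : S) : measurable_fun setT (pair x : U -> S * U).
Proof. exact: measurable_fun_pair. Qed.

Let graph_measure z : isMeasure _ _ _ (graph_kernel z).
Proof.
split; first by rewrite /graph_kernel /pushforward preimage_set0 measure0.
  by move=> A; exact: measure_ge0.
move=> F mF tF mUF; rewrite /graph_kernel /pushforward preimage_bigcup.
have mpF n : measurable (pair z.2 @^-1` F n : set U).
  by rewrite -[X in measurable X]setTI; exact: mpair.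
apply: measure_semi_sigma_additive => //; last exact: bigcup_measurable.
apply/trivIsetP => /= i j _ _ ij; rewrite -preimage_setI.
by move/trivIsetP : tF => /(_ i j Logic.I Logic.I ij) ->; rewrite preimage_set0.
Qed.
HB.instance Definition _ z := graph_measure z.

Definition mgraph_kernel : unit * S -> {measure set (S * U) -> \bar R} :=
  graph_kernel.

Let measurable_graph A : measurable A ->
  measurable_fun setT (mgraph_kernel ^~ A).
Proof.
move=> mA; rewrite (_ : mgraph_kernel ^~ A =
    (fun x => k x (xsection A x)) \o snd).
  apply: measurableT_comp => //.
  by apply: measurable_fun_xsection_finite_kernel; rewrite inE.
by apply/funext => z /=; rewrite /graph_kernel /pushforward xsectionE.
Qed.
HB.instance Definition _ :=
  isKernel.Build _ _ _ _ _ mgraph_kernel measurable_graph.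

Let graph_sprob : ereal_sup [set mgraph_kernel z setT | z in setT] <= 1.
Proof.
by apply/(sprob_kernelP mgraph_kernel) => z; exact: (sprob_kernel_le1 k z.2).
Qed.
HB.instance Definition _ :=
  Kernel_isSubProbability.Build _ _ _ _ _ mgraph_kernel graph_sprob.

End graph_kernel.

Section disintegration.
Context d d' d'' (T : measurableType d) (S : measurableType d')
  (U : measurableType d'') (R : realType) (P : probability T R).
Context (Y : T -> U) (Z : T -> S) (k : R.-spker S ~> U).
Hypothesis mY : measurable_fun setT Y.
Hypothesis mZ : measurable_fun setT Z.
Hypothesis YZ : conditional_distribution P Y Z (fun z => k z).

(** The law of [(Z, Y)] and the composition of the law of [Z] with the graph
    kernel of [k] agree on rectangles, hence everywhere. *)
Lemma disintegration (F : S * U -> \bar R) :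
  measurable_fun setT F -> (forall x, 0 <= F x) ->
  \int[P]_w F (Z w, Y w) = \int[P]_w \int[k (Z w)]_y F (Z w, y).
Proof.
move=> mF F0.
have mZY : measurable_fun setT (fun w => (Z w, Y w))
  by exact: measurable_fun_pair.
pose Z' : {mfun T >-> S} := HB.pack Z (isMeasurableFun.Build _ _ _ _ _ mZ).
pose ZY : {mfun T >-> (S * U)%type} :=
  HB.pack (fun w => (Z w, Y w)) (isMeasurableFun.Build _ _ _ _ _ mZY).
pose l : R.-pker unit ~> S :=
  kprobability
    (@measurable_cst _ _ unit (pprobability S R) setT (distribution P Z')).
pose m := mkcomp l (mgraph_kernel k) tt.
have mE A : measurable A -> distribution P ZY A = m A.
  pose C := [set A `*` B | A in @measurable _ S & B in @measurable _ U].
  apply: (measure_unique C (fun=> setT)) => //.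
  - by rewrite measurable_prod_measurableType.
  - move=> _ _ [A1 mA1 [B mB <-]] [A' mA' [B' mB' <-]].
    exists (A1 `&` A'); first exact: measurableI.
    by exists (B `&` B'); [exact: measurableI|rewrite setXI].
  - by move=> _; exists setT => //; exists setT => //; rewrite setXTT.
  - by rewrite bigcup_const.
  - move=> _ [A' mA' [B mB <-]].
    transitivity (P (Z @^-1` A' `&` Y @^-1` B)); first by [].
    rewrite YZ//.
    rewrite /m /mkcomp /kcomp /=.
    transitivity (\int[distribution P Z']_(z in A') k z B).
      by rewrite (ge0_integral_pushforward mZ)//;
        exact/measurable_funTS/measurable_kernel.
    rewrite integral_mkcond; apply: eq_integral => z _.
    rewrite patchE.
    transitivity (k z (xsection (A' `*` B) z)); last by rewrite xsectionE.
    by case: ifPn => zA; [rewrite in_xsectionX|rewrite notin_xsectionX//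
      measure0].
  - by move=> _; rewrite [ltLHS]probability_setT ltry.
transitivity (\int[distribution P ZY]_x F x).
  by rewrite ge0_integral_distribution.
transitivity (\int[m]_x F x).
  by apply: eq_measure_integral => A mA _; exact: mE.
rewrite integral_kcomp//.
transitivity (\int[distribution P Z']_z \int[k z]_y F (z, y)).
  apply: eq_integral => z _.
  have mp : measurable_fun setT (pair z : U -> S * U).
    by exact: measurable_fun_pair.
  by rewrite -[RHS](ge0_integral_pushforward mp (k z) measurableT mF
    (fun x _ => F0 x)).
rewrite ge0_integral_distribution//.
  exact: measurable_fun_integral_finite_kernel.
by move=> z; exact: integral_ge0.
Qed.

End disintegration.

(** * Increments of a supermodular function *)

Section increments.
Context (R : realType) (k : R.-pker R ~> R) (h : R * R -> R).
Hypothesis k_mono : stochastically_monotone k.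
Hypothesis mh : measurable_fun setT h.
Hypothesis h_super : supermodular h.

(** The increment of [h (., y)] from [a] to [b]. Relative to its value at
    [y = 0], it is split into its variation [inc_up] over [y > 0] and its
    variation [inc_down] over [y < 0]: both are nonnegative for [a <= b]. *)
Definition inc (a b y : R) : R := (h (b, y) - h (a, y))%R.
Definition inc_up (a b y : R) : R := (inc a b (Num.max y 0) - inc a b 0)%R.
Definition inc_down (a b y : R) : R := (inc a b 0 - inc a b (Num.min y 0))%R.

Lemma incE a b y : inc a b y = (inc a b 0 + inc_up a b y - inc_down a b y)%R.
Proof.
rewrite /inc_up /inc_down; case: (leP 0%R y) => _; lra.
Qed.

Lemma incC a b y : (inc a b y = - inc b a y)%R.
Proof. by rewrite /inc opprB. Qed.

Lemma inc_homo a b : (a <= b)%R -> {homo inc a b : y y' / (y <= y')%R}.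
Proof. by move=> ab y y' yy'; have := h_super ab yy'; rewrite /inc; lra. Qed.

Lemma measurable_inc a b : measurable_fun setT (inc a b).
Proof.
by apply: measurable_funB; apply: measurableT_comp => //;
  exact: measurable_fun_pair.
Qed.

Lemma inc_up_homo a b : (a <= b)%R -> {homo inc_up a b : y y' / (y <= y')%R}.
Proof.
move=> ab y y' yy'; rewrite lerB// inc_homo//.
by rewrite ge_max !le_max yy' lexx orbT.
Qed.

Lemma inc_down_homo a b : (a <= b)%R ->
  {homo inc_down a b : y y' /~ (y <= y')%R}.
Proof.
move=> ab y y' yy'; rewrite lerB// inc_homo//.
by rewrite le_min !ge_min yy' lexx orbT.
Qed.

Lemma inc_up_ge0 a b y : (a <= b)%R -> (0 <= inc_up a b y)%R.
Proof. by move=> ab; rewrite subr_ge0 inc_homo// le_max lexx orbT. Qed.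

Lemma inc_down_ge0 a b y : (a <= b)%R -> (0 <= inc_down a b y)%R.
Proof. by move=> ab; rewrite subr_ge0 inc_homo// ge_min lexx orbT. Qed.

Lemma measurable_inc_up a b : measurable_fun setT (inc_up a b).
Proof.
apply: measurable_funB => //; apply: measurableT_comp;
  first exact: measurable_inc.
exact: measurable_maxr.
Qed.

Lemma measurable_inc_down a b : measurable_fun setT (inc_down a b).
Proof.
apply: measurable_funB => //; apply: measurableT_comp;
  first exact: measurable_inc.
exact: measurable_minr.
Qed.

Definition mean_up a b s := \int[k s]_y (inc_up a b y)%:E.
Definition mean_down a b s := \int[k s]_y (inc_down a b y)%:E.

Lemma mean_up_additive s : interval_additive (fun a b => mean_up a b s).
Proof.
split=> [a b ab|a b c ab bc].
  by apply: integral_ge0 => y _; rewrite lee_fin inc_up_ge0.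
rewrite /mean_up -ge0_integralD//.
- by apply: eq_integral => y _; rewrite -EFinD /inc_up /inc; congr (_%:E); ring.
all: try by move=> y _; rewrite lee_fin inc_up_ge0.
all: by apply/measurable_EFinP; exact: measurable_inc_up.
Qed.

Lemma mean_down_additive s : interval_additive (fun a b => mean_down a b s).
Proof.
split=> [a b ab|a b c ab bc].
  by apply: integral_ge0 => y _; rewrite lee_fin inc_down_ge0.
rewrite /mean_down -ge0_integralD//.
- by apply: eq_integral => y _; rewrite -EFinD /inc_down /inc; congr (_%:E);
  ring.
all: try by move=> y _; rewrite lee_fin inc_down_ge0.
all: by apply/measurable_EFinP; exact: measurable_inc_down.
Qed.

Lemma mean_up_mono a b s t : (a <= b)%R -> (s <= t)%R ->
  mean_up a b s <= mean_up a b t.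
Proof.
move=> ab st.
apply: (@stoch_le_integral _ (kernel_prob k s) (kernel_prob k t)).
- by move=> y; exact: k_mono.
- by move=> y; exact: inc_up_ge0.
- exact: inc_up_homo.
Qed.

Lemma mean_down_anti a b s t : (a <= b)%R -> (s <= t)%R ->
  mean_down a b t <= mean_down a b s.
Proof.
move=> ab st.
apply: (@stoch_le_integral_anti _ (kernel_prob k s) (kernel_prob k t)).
- by move=> y; exact: k_mono.
- by move=> y; exact: inc_down_ge0.
- exact: inc_down_homo.
Qed.

(** The mean of the positive part of the increment; that of its negative part
    is [mean_pos b a s]. *)
Definition mean_pos a b s := \int[k s]_y (Num.max (inc a b y) 0)%:E.

Lemma mean_pos_ge0 a b s : 0 <= mean_pos a b s.
Proof. by apply: integral_ge0 => y _; rewrite lee_fin le_max lexx orbT. Qed.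

(** Integrating [incE]. Both parts are bounded by [|inc a b y| + |inc a b 0|],
    and [k s] has finite mass. *)
Lemma mean_pos_decomposition a b s : (a <= b)%R ->
  mean_pos a b s < +oo -> mean_pos b a s < +oo ->
  [/\ mean_up a b s < +oo, mean_down a b s < +oo &
    (fine (mean_pos a b s) - fine (mean_pos b a s) =
     inc a b 0 + fine (mean_up a b s) - fine (mean_down a b s))%R].
Proof.
move=> ab pab pba.
have mp c e : measurable_fun setT (fun y => (Num.max (inc c e y) 0)%:E).
  by apply/measurable_EFinP/measurable_maxr => //; exact: measurable_inc.
have p0 c e y : 0 <= (Num.max (inc c e y) 0)%:E
  by rewrite lee_fin le_max lexx orbT.
have mu := measurable_inc_up a b; have md := measurable_inc_down a b.
have bound (g : R -> R) : measurable_fun setT g -> (forall y, 0 <= g y)%R ->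
    (forall y, g y <= Num.max (inc a b y) 0 + Num.max (inc b a y) 0 +
      `|inc a b 0|)%R ->
    \int[k s]_y (g y)%:E < +oo.
  move=> mg g0 gle.
  apply: (@le_lt_trans _ _ (\int[k s]_y ((Num.max (inc a b y) 0)%:E +
      (Num.max (inc b a y) 0)%:E + (`|inc a b 0|)%:E))).
    apply: ge0_le_integral => //.
    - by move=> y _; rewrite lee_fin.
    - exact/measurable_EFinP.
    - by apply: emeasurable_funD => //; exact: emeasurable_funD.
    - by move=> y _; rewrite -!EFinD lee_fin.
  rewrite ge0_integralD//; last exact: emeasurable_funD; last first.
    by move=> y _; exact: adde_ge0.
  rewrite ge0_integralD// integral_cst// prob_kernel mule1.
  by rewrite lte_add_pinfty ?ltry// lte_add_pinfty.
have fup : mean_up a b s < +oo.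
  apply: bound => //; first by move=> y; exact: inc_up_ge0.
  move=> y; rewrite (incC b a) /inc_up; have := ler_norm (- inc a b 0).
  rewrite normrN; have [y0|y0] := leP 0%R y.
    by rewrite /Num.max; repeat (case: ifPn; rewrite -?leNgt); lra.
  rewrite subrr; have := normr_ge0 (inc a b 0).
  by rewrite /Num.max; repeat (case: ifPn; rewrite -?leNgt); lra.
have fdown : mean_down a b s < +oo.
  apply: bound => //; first by move=> y; exact: inc_down_ge0.
  move=> y; rewrite (incC b a) /inc_down; have := ler_norm (inc a b 0).
  have [y0|y0] := leP y 0%R.
    by rewrite /Num.max; repeat (case: ifPn; rewrite -?leNgt); lra.
  rewrite subrr; have := normr_ge0 (inc a b 0).
  by rewrite /Num.max; repeat (case: ifPn; rewrite -?leNgt); lra.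
split=> //.
have : mean_pos a b s + mean_down a b s + (Num.max (- inc a b 0) 0)%:E =
    mean_pos b a s + mean_up a b s + (Num.max (inc a b 0) 0)%:E.
  have cst c : (Num.max c 0)%:E = \int[k s]_y (Num.max c 0)%:E.
    by rewrite integral_cst// prob_kernel mule1.
  rewrite (cst (inc a b 0)) (cst (- inc a b 0)%R) /mean_pos /mean_up /mean_down.
  rewrite -!ge0_integralD//=.
  - apply: eq_integral => y _; rewrite -!EFinD; congr (_%:E).
    rewrite (incC b a) (incE a b y).
    by rewrite /Num.max; repeat (case: ifPn; rewrite -?leNgt); lra.
  all: try by move=> y _; rewrite -?EFinD lee_fin; repeat first
    [exact: inc_up_ge0 | exact: inc_down_ge0 |
      by rewrite le_max lexx orbT | apply: addr_ge0].
  all: try exact/measurable_EFinP.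
  1-2: by apply: emeasurable_funD => //; exact/measurable_EFinP.
have Gu0 := (mean_up_additive s).1 _ _ ab.
have Gd0 := (mean_down_additive s).1 _ _ ab.
rewrite -(fineK (_ : mean_pos a b s \is a fin_num)) ?ge0_fin_numE
  ?mean_pos_ge0//.
rewrite -(fineK (_ : mean_pos b a s \is a fin_num)) ?ge0_fin_numE
  ?mean_pos_ge0//.
rewrite -(fineK (_ : mean_up a b s \is a fin_num)) ?ge0_fin_numE//.
rewrite -(fineK (_ : mean_down a b s \is a fin_num)) ?ge0_fin_numE//=.
move=> [].
by rewrite /Num.max; repeat (case: ifPn; rewrite -?leNgt); lra.
Qed.

End increments.

(** * Comparison of the two couplings *)

Section comparison.
Context d (T : measurableType d) (R : realType) (P : probability T R).
Context (X Y Z : T -> R) (k : R.-pker R ~> R) (h : R * R -> R).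
Hypothesis mX : measurable_fun setT X.
Hypothesis mY : measurable_fun setT Y.
Hypothesis mZ : measurable_fun setT Z.
Hypothesis XY : same_law P X Y.
Hypothesis Zk :
  conditional_distribution P Z (fun w => (X w, Y w)) (fun z => k z.2).
Hypothesis k_mono : stochastically_monotone k.
Hypothesis mh : measurable_fun setT h.
Hypothesis h_super : supermodular h.
Hypothesis iX : P.-integrable setT (fun w => (h (X w, Z w))%:E).
Hypothesis iY : P.-integrable setT (fun w => (h (Y w, Z w))%:E).

Let A1 w := mean_pos k h (X w) (Y w) (Y w).
Let A2 w := mean_pos k h (Y w) (X w) (Y w).
Let dpos w := (Num.max (inc h (X w) (Y w) (Z w)) 0)%:E.
Let dneg w := (Num.max (inc h (Y w) (X w) (Z w)) 0)%:E.

Let mXY : measurable_fun setT (fun w => (X w, Y w)).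
Proof. exact: measurable_fun_pair. Qed.

(** Given [(X, Y)], the positive and the negative part of [h (Y, Z) - h (X, Z)]
    have conditional means [A1] and [A2], which are almost surely finite. The
    potential is [phi x = h (x, 0) + primitive rp x - primitive rm x], where
    [rp] and [rm] are the diagonal integrals of [mean_up] and [mean_down]. *)
Lemma supermodular_expectation_le :
  'E_P[fun w => h (X w, Z w)] <= 'E_P[fun w => h (Y w, Z w)].
Proof.
pose F1 (z : R * R * R) := (Num.max (inc h z.1.1 z.1.2 z.2) 0)%:E.
pose F2 (z : R * R * R) := (Num.max (inc h z.1.2 z.1.1 z.2) 0)%:E.
have mF1 : measurable_fun setT F1.
  apply/measurable_EFinP/measurable_maxr => //; apply: measurable_funB.
  - apply: (measurableT_comp mh); apply: measurable_fun_pair => //.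
    exact: measurableT_comp.
  - apply: (measurableT_comp mh); apply: measurable_fun_pair => //.
    exact: measurableT_comp.
have mF2 : measurable_fun setT F2.
  apply/measurable_EFinP/measurable_maxr => //; apply: measurable_funB.
  - apply: (measurableT_comp mh); apply: measurable_fun_pair => //.
    exact: measurableT_comp.
  - apply: (measurableT_comp mh); apply: measurable_fun_pair => //.
    exact: measurableT_comp.
have F10 z : 0 <= F1 z by rewrite lee_fin le_max lexx orbT.
have F20 z : 0 <= F2 z by rewrite lee_fin le_max lexx orbT.
have A10 w : 0 <= A1 w by exact: mean_pos_ge0.
have A20 w : 0 <= A2 w by exact: mean_pos_ge0.
pose k' := kernel.kernel_snd (T0 := R) k.
have E1 : \int[P]_w dpos w = \int[P]_w A1 w.
  exact: (@disintegration _ _ _ _ _ _ _ P Z (fun w => (X w, Y w)) k'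
    mZ mXY Zk F1 mF1 F10).
have E2 : \int[P]_w dneg w = \int[P]_w A2 w.
  exact: (@disintegration _ _ _ _ _ _ _ P Z (fun w => (X w, Y w)) k'
    mZ mXY Zk F2 mF2 F20).
have mA1 : measurable_fun setT A1.
  apply: (@measurableT_comp _ _ _ _ _ _
    (fun z => \int[k' z]_y F1 (z, y)) _ (fun w => (X w, Y w))) => //.
  exact: measurable_fun_integral_finite_kernel.
have mA2 : measurable_fun setT A2.
  apply: (@measurableT_comp _ _ _ _ _ _
    (fun z => \int[k' z]_y F2 (z, y)) _ (fun w => (X w, Y w))) => //.
  exact: measurable_fun_integral_finite_kernel.
have iD : P.-integrable setT (fun w => (inc h (X w) (Y w) (Z w))%:E).
  by have := integrableB measurableT iY iX; apply: eq_integrable.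
have dposE : dpos = (fun w => (inc h (X w) (Y w) (Z w))%:E)^\+.
  by apply/funext => w; rewrite /dpos funeposE -EFin_max.
have dnegE : dneg = (fun w => (inc h (X w) (Y w) (Z w))%:E)^\-.
  by apply/funext => w; rewrite /dneg funenegE -EFinN -EFin_max -incC.
have dpos_fin : \int[P]_w dpos w < +oo.
  by rewrite dposE; exact: integral_funepos_lt_pinfty.
have dneg_fin : \int[P]_w dneg w < +oo.
  by rewrite dnegE; exact: integral_funeneg_lt_pinfty.
have ae_fin (A : T -> \bar R) : measurable_fun setT A -> (forall w, 0 <= A w) ->
    \int[P]_w A w < +oo -> {ae P, forall w, A w < +oo}.
  move=> mA A0 iA; have /integrable_ae : P.-integrable setT A.
    by apply/integrableP; split => //; under eq_integral do rewrite gee0_abs//.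
  by move/(_ measurableT); apply: filterS => w /(_ Logic.I);
    rewrite ge0_fin_numE.
have ae1 : {ae P, forall w, A1 w < +oo} by apply: ae_fin; rewrite -?E1.
have ae2 : {ae P, forall w, A2 w < +oo} by apply: ae_fin; rewrite -?E2.
have [rp rp_add Grp] := exists_diagonal_integral
  (mean_up_additive k mh h_super) (mean_up_mono k_mono h_super).
have [rm rm_add Grm] := exists_diagonal_integral_anti
  (mean_down_additive k mh h_super) (mean_down_anti k_mono h_super).
have lp : {ae P, forall w, linked rp (X w) (Y w)}.
  apply: ae_linked => //; apply: filterS2 ae1 ae2 => w A1w A2w xy.
  have [Gp _ _] := mean_pos_decomposition mh h_super xy A1w A2w.
  by have /andP[_ /le_lt_trans] := Grp _ _ xy; apply.
have lm : {ae P, forall w, linked rm (Y w) (X w)}.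
  apply: ae_linked => //; first exact: same_law_sym.
  apply: filterS2 ae1 ae2 => w A1w A2w yx.
  have [_ Gm _] := mean_pos_decomposition mh h_super yx A2w A1w.
  by have /andP[_ /le_lt_trans] := Grm _ _ yx; apply.
pose phi x := (h (x, 0) + primitive rp x - primitive rm x)%R.
have mphi : measurable_fun setT phi.
  apply: measurable_funB; last exact: measurable_primitive.
  apply: measurable_funD; last exact: measurable_primitive.
  by apply: (measurableT_comp mh); exact: measurable_fun_pair.
(* The lower bound of the conditional mean of [h (Y, Z) - h (X, Z)] by
   [phi Y - phi X], written without subtracting infinite quantities. *)
have key : {ae P, forall w, (phi (Y w) - phi (X w))%:E + A2 w <= A1 w}.
  have ae12 : {ae P, forall w, A1 w < +oo /\ A2 w < +oo}
    by apply: filterS2 ae1 ae2.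
  apply: filterS3 ae12 lp lm => w [A1w A2w] lpw lmw.
  rewrite -(fineK (_ : A1 w \is a fin_num)) ?ge0_fin_numE//.
  rewrite -(fineK (_ : A2 w \is a fin_num)) ?ge0_fin_numE// -EFinD lee_fin
    -lerBrDr.
  have fin (a b : \bar R) : a <= b -> 0 <= a -> b < +oo -> (fine a <= fine b)%R.
    move=> ab a0 boo; have aoo := le_lt_trans ab boo.
    have fa : a \is a fin_num by rewrite ge0_fin_numE.
    have fb : b \is a fin_num by rewrite ge0_fin_numE// (le_trans a0).
    exact: fine_le.
  have [xy|/ltW yx] := leP (X w) (Y w).
    have [Gp Gm] := mean_pos_decomposition mh h_super xy A1w A2w.
    rewrite -/(A1 w) -/(A2 w) => ->.
    have /andP[_ lep] := Grp _ _ xy; have /andP[lem _] := Grm _ _ xy.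
    rewrite linked_le// in lpw; move/linkedC : lmw; rewrite linked_le// => lmw.
    have := fin _ _ lep (rp_add.1 _ _ xy) Gp.
    have := fin _ _ lem ((mean_down_additive k mh h_super _).1 _ _ xy) lmw.
    rewrite -(primitiveB rp_add xy lpw) -(primitiveB rm_add xy lmw).
    by rewrite /phi /inc; lra.
  have [Gp Gm] := mean_pos_decomposition mh h_super yx A2w A1w.
  rewrite -/(A1 w) -/(A2 w) => e.
  have /andP[lep _] := Grp _ _ yx; have /andP[_ lem] := Grm _ _ yx.
  rewrite linked_le// in lmw; move/linkedC : lpw; rewrite linked_le// => lpw.
  have := fin _ _ lep ((mean_up_additive k mh h_super _).1 _ _ yx) lpw.
  have := fin _ _ lem (rm_add.1 _ _ yx) Gm.
  rewrite -(primitiveB rp_add yx lpw) -(primitiveB rm_add yx lmw).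
  by move: e; rewrite /phi /inc; lra.
have le12 : \int[P]_w dneg w <= \int[P]_w dpos w.
  rewrite E1 E2.
  apply: (same_law_le_integral _ _ (same_law_comp mphi XY)
    mA1 A10 mA2 A20 _ key).
  - exact: measurableT_comp.
  - exact: measurableT_comp.
  - by rewrite -E1.
rewrite !unlock -subre_ge0; last first.
  by have := integrable_fin_num measurableT iY.
have <- : \int[P]_w (inc h (X w) (Y w) (Z w))%:E =
    \int[P]_w (h (Y w, Z w))%:E - \int[P]_w (h (X w, Z w))%:E.
  by rewrite -integralB_EFin.
rewrite integralE -dposE -dnegE subre_ge0//.
by rewrite ge0_fin_numE// integral_ge0// => w _;
  rewrite lee_fin le_max lexx orbT.
Qed.

End comparison.

(** * Covariances *)

Section two_step.
Context (R : realType) (p1 p2 : R.-pker R ~> R).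

Definition two_step : R -> {measure set R -> \bar R} :=
  kernel.mkcomp_noparam p1 p2.

HB.instance Definition _ := SubProbabilityKernel.on two_step.

Let two_step_prob x : two_step x setT = 1.
Proof.
transitivity (\int[p1 x]_y p2 y setT); first by [].
under eq_integral do rewrite prob_kernel.
by rewrite integral_cst// prob_kernel mule1.
Qed.
HB.instance Definition _ :=
  isProbabilityKernel.Build _ _ _ _ _ two_step two_step_prob.

Lemma two_step_mono :
  stochastically_monotone p1 -> stochastically_monotone p2 ->
  stochastically_monotone two_step.
Proof.
move=> m1 m2 y x1 x2 x12.
have fin z : p2 z `]y, +oo[%classic \is a fin_num.
  exact: (@fin_num_measure _ _ _ (kernel_prob p2 z)).
have e x : two_step x `]y, +oo[%classic =
    \int[p1 x]_z (fine (p2 z `]y, +oo[%classic))%:E.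
  by transitivity (\int[p1 x]_z p2 z `]y, +oo[%classic) => //;
    apply: eq_integral => z _; rewrite fineK.
rewrite !e.
apply: (@stoch_le_integral _ (kernel_prob p1 x1) (kernel_prob p1 x2)).
- by move=> z; exact: m1.
- by move=> z; exact: fine_ge0.
- by move=> z1 z2 z12; apply: fine_le => //; exact: m2.
Qed.

Lemma chain_two_step d (T : measurableType d) (P : probability T R)
    (X0 X1 X2 : {RV P >-> R}) : markov_chain3 X0 X1 X2 p1 p2 ->
  conditional_distribution P X2 X0 (fun x => two_step x).
Proof.
move=> [c1 c2] C B mC mB.
have mX0 : measurable_fun setT X0 by exact: measurable_funPT.
have mX1 : measurable_fun setT X1 by exact: measurable_funPT.
have := c2 (C `*` setT) B (measurableX mC measurableT) mB.
rewrite (_ : _ @^-1` (C `*` setT) = X0 @^-1` C); last first.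
  by apply/seteqP; split => w //= [].
move=> ->; rewrite [LHS]integral_mkcond [RHS]integral_mkcond.
pose F (z : R * R) := (\1_C z.1)%:E * p2 z.2 B.
have mF : measurable_fun setT F.
  apply: emeasurable_funM;
    last exact: (measurableT_comp (measurable_kernel p2 _ mB)).
  by apply/measurable_EFinP; apply: measurableT_comp.
have F0 z : 0 <= F z by rewrite mule_ge0// lee_fin.
transitivity (\int[P]_w F (X0 w, X1 w)).
  apply: eq_integral => w _; rewrite patchE /F indicE/=.
  rewrite (_ : (w \in X0 @^-1` C) = (X0 w \in C));
    last by apply/idP/idP; rewrite !inE.
  by case: ifP => _; rewrite ?mul1e ?mul0e.
rewrite (disintegration mX1 mX0 c1 mF F0).
apply: eq_integral => w _; rewrite patchE.
rewrite (_ : (w \in X0 @^-1` C) = (X0 w \in C));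
  last by apply/idP/idP; rewrite !inE.
rewrite /F /= indicE; case: (X0 w \in C).
  by apply: eq_integral => y _; rewrite mul1e.
by apply: integral0_eq => y _; rewrite mul0e.
Qed.

End two_step.

(** On the product space, [X w.1] is a copy of [X] that is independent of
    [X w.2] and [Z w.2]; conditioning on it as well changes nothing. *)
Lemma independent_copy_conditional d (T : measurableType d) (R : realType)
    (P : probability T R) (X Z : T -> R) (k : R.-pker R ~> R) :
  measurable_fun setT X -> measurable_fun setT Z ->
  conditional_distribution P Z X (fun x => k x) ->
  conditional_distribution (P \x P) (Z \o snd)
    (fun w => (X w.1, X w.2)) (fun z => k z.2).
Proof.
move=> mX mZ XZ C B mC mB.
have mXX : measurable_fun setT (fun w : T * T => (X w.1, X w.2)).
  by apply: measurable_fun_pair; exact: measurableT_comp.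
have mpC : measurable ((fun w : T * T => (X w.1, X w.2)) @^-1` C).
  by rewrite -[S in measurable S]setTI; exact: mXX.
have mS : measurable ((fun w : T * T => (X w.1, X w.2)) @^-1` C `&`
    (Z \o snd) @^-1` B).
  apply: measurableI => //; rewrite -[S in measurable S]setTI.
  have : measurable_fun setT (Z \o snd : T * T -> R) by exact: measurableT_comp.
  by apply.
pose G (w : T * T) := (\1_C (X w.1, X w.2))%:E * k (X w.2) B.
have mG : measurable_fun setT G.
  apply: emeasurable_funM.
    by apply/measurable_EFinP; exact: (measurableT_comp (measurable_indic mC)).
  by apply: (measurableT_comp (measurable_kernel k _ mB));
    exact: measurableT_comp.
have G0 w : 0 <= G w by rewrite mule_ge0// lee_fin.
rewrite [RHS]integral_mkcond.
transitivity (\int[P \x P]_w G w); last first.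
  apply: eq_integral => w _; rewrite patchE /G indicE/=.
  rewrite (_ : (w \in _ @^-1` C) = ((X w.1, X w.2) \in C));
    last by apply/idP/idP; rewrite !inE.
  by case: ifP => _; rewrite ?mul1e ?mul0e.
rewrite fubini_tonelli1//.
apply: eq_integral => u _; rewrite /fubini_F /=.
have mCu : measurable (xsection C (X u)) by exact: measurable_xsection.
transitivity (P (X @^-1` (xsection C (X u)) `&` Z @^-1` B)).
  congr (P _); apply/seteqP; split => w; rewrite /xsection /= !inE/=.
    by move=> [? ?].
  by move=> [? ?].
rewrite XZ// integral_mkcond; apply: eq_integral => w _.
rewrite patchE /G indicE/=.
rewrite (_ : (w \in _) = ((X u, X w) \in C)); last first.
  by apply/idP/idP; rewrite /xsection !inE/= ?inE.
by case: ifP => _; rewrite ?mul1e ?mul0e.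
Qed.

Lemma supermodularM (R : realType) (f1 f2 : R -> R) :
  {homo f1 : x y / (x <= y)%R} -> {homo f2 : x y / (x <= y)%R} ->
  supermodular (fun z => f1 z.1 * f2 z.2)%R.
Proof.
move=> m1 m2 x1 x2 y1 y2 /m1 x12 /m2 y12 /=; rewrite -subr_ge0.
by rewrite [leRHS](_ : _ = (f1 x2 - f1 x1) * (f2 y2 - f2 y1))%R;
  [rewrite mulr_ge0 ?subr_ge0|ring].
Qed.

(** Chebyshev's association inequality. It compares [(X w.1, Z w.2)], whose
    coordinates are independent, with [(X w.2, Z w.2)]. *)
Lemma expectation_mul_ge d (T : measurableType d) (R : realType)
    (P : probability T R) (X Z : T -> R) (k : R.-pker R ~> R) (f1 f2 : R -> R) :
  measurable_fun setT X -> measurable_fun setT Z ->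
  conditional_distribution P Z X (fun x => k x) -> stochastically_monotone k ->
  {homo f1 : x y / (x <= y)%R} -> {homo f2 : x y / (x <= y)%R} ->
  P.-integrable setT (fun w => (f1 (X w))%:E) ->
  P.-integrable setT (fun w => (f2 (Z w))%:E) ->
  P.-integrable setT (fun w => (f1 (X w) * f2 (Z w))%:E) ->
  'E_P[f1 \o X] * 'E_P[f2 \o Z] <= 'E_P[fun w => f1 (X w) * f2 (Z w)]%R.
Proof.
move=> mX mZ XZ k_mono m1 m2 i1 i2 i12.
have mf1 : measurable_fun setT f1 by exact: nondecreasing_measurable.
have mf2 : measurable_fun setT f2 by exact: nondecreasing_measurable.
have m1X : measurable_fun setT (f1 \o X) by exact: measurableT_comp.
have m2Z : measurable_fun setT (f2 \o Z) by exact: measurableT_comp.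
pose Q : probability (T * T)%type R := P \x P.
pose h z : R := (f1 z.1 * f2 z.2)%R.
have mh : measurable_fun setT h.
  by apply: measurable_funM; exact: measurableT_comp.
have mh1 : measurable_fun setT (fun w : T * T => (h (X w.1, Z w.2))%:E).
  by apply/measurable_EFinP/measurable_funM;
    [exact: (measurableT_comp m1X)|exact: (measurableT_comp m2Z)].
have mh2 : measurable_fun setT (fun w : T * T => (h (X w.2, Z w.2))%:E).
  by apply/measurable_EFinP/measurable_funM;
    [exact: (measurableT_comp m1X)|exact: (measurableT_comp m2Z)].
have ih1 : (P \x P).-integrable setT (fun w => (h (X w.1, Z w.2))%:E).
  apply: (integrable12ltyP P P mh1).2.
  have e u : \int[P]_w `|(h (X u, Z w))%:E| =
      `|(f1 (X u))%:E| * \int[P]_w `|(f2 (Z w))%:E|.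
    rewrite -ge0_integralZl//; last first.
      by apply: measurableT_comp => //; exact/measurable_EFinP.
    by apply: eq_integral => w _; rewrite -abseM.
  under eq_integral do rewrite e.
  move/integrableP : i1 => [_ i1]; move/integrableP : i2 => [_ i2].
  rewrite ge0_integralZr//; last 2 first.
  - by apply: measurableT_comp => //; exact/measurable_EFinP.
  - exact: integral_ge0.
  by rewrite lte_mul_pinfty ?ge0_fin_numE ?integral_ge0.
have ih2 : (P \x P).-integrable setT (fun w => (h (X w.2, Z w.2))%:E).
  apply: (integrable12ltyP P P mh2).2 => /=.
  move/integrableP : i12 => [_ i12].
  by rewrite integral_cst//= probability_setT mule1.
have mX1 : measurable_fun setT (X \o fst : T * T -> R)
  by exact: measurableT_comp.
have mX2 : measurable_fun setT (X \o snd : T * T -> R)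
  by exact: measurableT_comp.
have mZ2 : measurable_fun setT (Z \o snd : T * T -> R)
  by exact: measurableT_comp.
have XX : same_law Q (X \o fst) (X \o snd).
  move=> A mA; have mXA : measurable (X @^-1` A).
    by rewrite -[S in measurable S]setTI; exact: mX.
  transitivity ((P \x P) (X @^-1` A `*` setT)).
    by congr (Q _); apply/seteqP; split => w //= [].
  transitivity ((P \x P) (setT `*` X @^-1` A)); last first.
    by congr (Q _); apply/seteqP; split => w //= [].
  by rewrite !product_measure1E// muleC.
have := supermodular_expectation_le mX1 mX2 mZ2 XX
  (independent_copy_conditional mX mZ XZ)
  k_mono mh (supermodularM m1 m2) ih1 ih2.
rewrite !unlock.
rewrite -(integral12_prod_meas1 ih1) -(integral12_prod_meas1 ih2).
rewrite [X in _ <= X -> _](_ : _ = \int[P]_w (f1 (X w) * f2 (Z w))%:E);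
  last first.
  transitivity (\int[P]_u cst (\int[P]_w (f1 (X w) * f2 (Z w))%:E) u) => //.
  by rewrite integral_cst//= probability_setT mule1.
apply: le_trans; rewrite le_eqVlt; apply/orP; left; apply/eqP.
transitivity (\int[P]_u ((f1 (X u))%:E * \int[P]_w (f2 (Z w))%:E)).
  have f2Z : \int[P]_w (f2 (Z w))%:E \is a fin_num.
    by have := integrable_fin_num measurableT i2.
  by rewrite -(fineK f2Z) integralZr.
apply: eq_integral => u _; rewrite /fubini_F -integralZl//.
Qed.

Theorem theorem1 (R : realType) (d : measure_display) (T : measurableType d)
    (P : probability T R) (X0 X1 X2 : {RV P >-> R})
    (p1 p2 : R.-pker R ~> R) (pi1 : probability R R)
    (chain : markov_chain3 X0 X1 X2 p1 p2)
    (mono1 : stochastically_monotone p1)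
    (mono2 : stochastically_monotone p2)
    (inv1 : invariant_distribution p1 pi1)
    (X0_pi1 : forall A : set R, measurable A -> distribution P X0 A = pi1 A) :
  (forall h : R * R -> R,
      measurable_fun [set: R * R] h -> supermodular h ->
      P.-integrable [set: T] (fun w => (h (X0 w, X2 w))%:E) ->
      P.-integrable [set: T] (fun w => (h (X1 w, X2 w))%:E) ->
      'E_P[fun w => h (X0 w, X2 w)] <= 'E_P[fun w => h (X1 w, X2 w)]) /\
  (forall f1 f2 : R -> R,
      {homo f1 : x y / (x <= y)%R} -> {homo f2 : x y / (x <= y)%R} ->
      P.-integrable [set: T] (fun w => (f1 (X0 w))%:E) ->
      P.-integrable [set: T] (fun w => (f2 (X2 w))%:E) ->
      P.-integrable [set: T] (fun w => (f1 (X0 w) * f2 (X2 w))%R%:E) ->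
      P.-integrable [set: T] (fun w => (f1 (X1 w) * f2 (X2 w))%R%:E) ->
      0 <= covariance P (f1 \o X0) (f2 \o X2) /\
      covariance P (f1 \o X0) (f2 \o X2) <= covariance P (f1 \o X1) (f2 \o X2)).
Proof.
have mX0 : measurable_fun setT X0 by exact: measurable_funPT.
have mX1 : measurable_fun setT X1 by exact: measurable_funPT.
have mX2 : measurable_fun setT X2 by exact: measurable_funPT.
have X01 : same_law P X0 X1.
  move=> A mA; transitivity (pi1 A); first exact: X0_pi1.
  have := chain.1 setT A measurableT mA; rewrite preimage_setT setTI => ->.
  rewrite -inv1//.
  have mp : measurable_fun setT (p1 ^~ A) by exact: measurable_kernel.
  rewrite -(@ge0_integral_distribution _ _ _ _ _ P X0 (p1 ^~ A))//.
  by apply: eq_measure_integral => B mB _; apply/esym; exact: X0_pi1.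
have main h : measurable_fun setT h -> supermodular h ->
    P.-integrable setT (fun w => (h (X0 w, X2 w))%:E) ->
    P.-integrable setT (fun w => (h (X1 w, X2 w))%:E) ->
    'E_P[fun w => h (X0 w, X2 w)] <= 'E_P[fun w => h (X1 w, X2 w)].
  by move=> mh sh; apply: supermodular_expectation_le mono2 mh sh => //;
    exact: chain.2.
split=> // f1 f2 m1 m2 i1 i2 i12 j12.
have mf1 : measurable_fun setT f1 by exact: nondecreasing_measurable.
have mf2 : measurable_fun setT f2 by exact: nondecreasing_measurable.
have j1 := integrable_same_law mX0 mX1 X01 mf1 i1.
have E01 : 'E_P[f1 \o X1] = 'E_P[f1 \o X0].
  by rewrite !unlock (integral_same_law mX0 mX1 X01 mf1).
have fin (g : T -> R) : P.-integrable setT (EFin \o g) -> 'E_P[g] \is a fin_num.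
  by move=> ig; rewrite unlock; have := integrable_fin_num measurableT ig.
have f12 : 'E_P[f1 \o X0] * 'E_P[f2 \o X2] \is a fin_num
  by rewrite fin_numM// fin.
rewrite !covarianceE; try by apply/Lfun1_integrable.
rewrite E01 suber_ge0//; split.
  exact: expectation_mul_ge mX0 mX2 (chain_two_step chain)
    (two_step_mono mono1 mono2) m1 m2 i1 i2 i12.
apply: leeD2r.
have mh : measurable_fun setT (fun z : R * R => f1 z.1 * f2 z.2)%R.
  by apply: measurable_funM; exact: measurableT_comp.
exact: main mh (supermodularM m1 m2) i12 j12.
Qed.
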